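(* Let $n\ge 1$ and let $\lambda\vdash n$ be a partition written as $\lambda=1^{j_1}2^{j_2}\cdots n^{j_n}$, where $j_i\ge 0$ denotes the number of parts of $\lambda$ equal to $i$. Let $\rho\in S_n$ be any permutation of cycle type $\lambda$, and let $$N(\lambda)=\left|\{(\sigma,\tau)\in S_n\times S_n:\ \sigma^2=\tau^2=1,\ \sigma\tau=\rho\}\right|.$$ Then $$N(\lambda)=\prod_{i=1}^n R_{j_i}(i),$$ where for integers $m\ge 0$ and $k\ge 1$, $$R_m(k)=\sum_{0\le i\le m/2}\frac{k^{m-i}\, m!}{2^i\, i!\,(m-2i)!}.$$
   Context: $S_n$ is the symmetric group on $[n]=\{1,\dots,n\}$; an involution is a permutation whose square is the identity (the identity itself included). The number $N(\lambda)$ does not depend on the choice of $\rho$ within the conjugacy class of cycle type $\lambda$. Note $R_0(k)=1$. *)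

(* Defs.v *)
From mathcomp Require Import all_boot all_order all_fingroup all_algebra.

Set Implicit Arguments.
Unset Strict Implicit.
Unset Printing Implicit Defensive.

Import GRing.Theory Num.Theory.
Local Open Scope ring_scope.

(* A partition is its weakly decreasing sequence of positive parts, so that
   j_i is count_mem i lam. *)
Definition is_partition_of (n : nat) (lam : seq nat) : bool :=
  [&& sorted geq lam, 0%N \notin lam & sumn lam == n].

(* Fixed points are orbits of size 1, hence contribute parts equal to 1. *)
Definition cycle_type (T : finType) (s : {perm T}) : seq nat :=
  sort geq [seq #|C| | C : {set T} <- enum (porbits s)].

(* The product of MathComp permutations applies the left factor first; with the
   opposite convention the set below is its image under swapping the two
   components, so the cardinal is the same. *)
Definition involution_factorizations (n : nat) (rho : 'S_n) :
    {set 'S_n * 'S_n} :=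
  [set p : 'S_n * 'S_n |
    [&& (p.1 ^+ 2 == 1)%g, (p.2 ^+ 2 == 1)%g & (p.1 * p.2 == rho)%g]].

Definition Rsum (m k : nat) : rat :=
  \sum_(0 <= i < (m./2).+1)
    (k%:R ^+ (m - i) * (m`!)%:R) / (2%:R ^+ i * (i`!)%:R * ((m - 2 * i)`!)%:R).

(* Main.v *)
Require Import Defs.
From mathcomp Require Import all_boot all_order all_fingroup all_algebra.

(** A factorization [rho = sigma tau] into involutions is the same as an
    involution [sigma] that conjugates [rho] to its inverse.  Such a [sigma]
    permutes the cycles of [rho], preserving lengths, and is determined on the
    cycle of a point [x] by [y = sigma x], since
    [sigma (rho^i x) = rho^-i y]; it must then exchange the cycles of [x] and
    [y].  If the cycle of [x] has length [k] and there are [m] cycles of length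
    [k], there are [k] choices of [y] on the same cycle and [k] on each of the
    [m - 1] others, whence the recurrence
    [R_m(k) = k R_{m-1}(k) + k (m - 1) R_{m-2}(k)], which the closed form
    satisfies. *)

Set Implicit Arguments.
Unset Strict Implicit.
Unset Printing Implicit Defensive.

Import GRing.Theory Num.Theory.

(* [R_m(k)] with [m! / (2^i i! (m - 2i)!)] written as the number of ways to
   choose [2i] points among [m] and match them: the terms with [2i > m] vanish. *)
Definition Rnat (m k : nat) : nat :=
  \sum_(i < m.+1) k ^ (m - i) * ('C(m, i.*2) * \prod_(j < i) j.*2.+1).

(** * The closed form of R_m(k) and its recurrence *)

Lemma prod_odd_fact i : (\prod_(j < i) j.*2.+1) * (2 ^ i * i`!) = (i.*2)`!.
Proof.
elim: i => [|i IH]; first by rewrite big_ord0.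
rewrite big_ord_recr /= doubleS !factS expnS -IH.
by rewrite -(doubleS i) -[i.+1.*2]mul2n [2 * _ * _]mulnACA mulnCA
  (mulnC _ i.*2.+1) !mulnA.
Qed.

Lemma Rnat0 k : Rnat 0 k = 1.
Proof. by rewrite /Rnat big_ord1 big_ord0. Qed.

Lemma Rnat1 k : Rnat 1 k = k.
Proof. by rewrite /Rnat big_ord_recr big_ord1 big_ord0 /= !muln1 addn0. Qed.

Lemma RnatS m k : Rnat m.+2 k = k * Rnat m.+1 k + k * (m.+1 * Rnat m k).
Proof.
rewrite /Rnat big_ord_recl /= big_ord0 subn0 bin0 !muln1.
rewrite [in RHS]big_ord_recl /= big_ord0 subn0 bin0 !muln1.
rewrite mulnDr -expnS -addnA; congr (_ + _).
(* The term of index m + 2 on the left has a vanishing binomial coefficient, so all sums now share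
   one range. *)
rewrite big_ord_recr /= bin_small ?mul0n ?muln0 ?addn0; last first.
  by rewrite /bump /= add1n -addnn addnS ltnS leq_addr.
rewrite mulnA !big_distrr -big_split /=; apply: eq_bigr => i _.
have le_im : i <= m by rewrite -ltnS.
rewrite /bump add1n doubleS !subSS big_ord_recr; set d := \prod_(j < i) _.
(* Pascal's rule, then (2i+1) C(m+1, 2i+1) = (m+1) C(m, 2i): a given point is unmatched or has one
   of [m.+1] partners. *)
have -> : 'C(m.+2, i.*2.+2) * (d * i.*2.+1)
    = 'C(m.+1, i.*2.+2) * (d * i.*2.+1) + m.+1 * ('C(m, i.*2) * d).
  rewrite binS mulnDl; congr (_ + _).
  by rewrite (mulnC d) mulnA (mulnC _ i.*2.+1) -mul_bin_diag !mulnA.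
by rewrite mulnDr subSn // expnS -!mulnA (mulnCA (k ^ _) m.+1).
Qed.

Lemma Rsum_Rnat m k : Rsum m k = (Rnat m k)%:R%R.
Proof.
pose F i : nat := k ^ (m - i) * ('C(m, i.*2) * \prod_(j < i) j.*2.+1).
rewrite /Rsum /Rnat natr_sum -(big_mkord xpredT (fun i => (F i)%:R%R)) {}/F.
have le_half : m./2.+1 <= m.+1.
  by rewrite ltnS leq_half_double -addnn -addnS leq_addr.
rewrite (big_cat_nat (leq0n _) le_half) /=.
rewrite [X in (_ + X)%R]big_nat [X in (_ + X)%R]big1; last first.
  move=> i /andP[lt_i _]; rewrite bin_small ?mul0n ?muln0 //.
  by rewrite -ltn_half_double.
rewrite addr0 !big_nat; apply: eq_bigr => i /=; rewrite ltnS => le_i.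
have le_2i : i.*2 <= m by rewrite -geq_half_double.
rewrite mul2n; set d := (X in (_ / X)%R).
have d_neq0 : d != 0%R.
  by rewrite /d !mulf_neq0 ?expf_neq0 ?pnatr_eq0 -?lt0n ?fact_gt0.
apply: (mulIf d_neq0); rewrite mulfVK // /d -!natrX -!natrM.
(* m! = C(m, 2i) (2i)! (m - 2i)!, and (2i)! contains the factor 2^i i! of the denominator. *)
congr (_%:R)%R; rewrite -(bin_fact le_2i) -prod_odd_fact.
by rewrite !mulnA; congr (_ * _); rewrite -!mulnA.
Qed.

(** * Powers of [rho] along a cycle *)

Section Inverters.
Variables (T : finType) (rho : {perm T}).
Implicit Types (x y z : T) (s t : {perm T}) (D E : {set T}) (P : {set {set T}}).
Local Open Scope group_scope.

(** With K the cycle length, rho^K fixes [x] and the first K iterates are distinct, so only m mod K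
    matters. *)
Lemma porbit_expg_id x m : ((rho ^+ m) x == x) = (#|porbit rho x| %| m).
Proof.
set K := #|_|; have K_gt0 : 0 < K by rewrite lt0n card_porbit_neq0.
have idK j : (rho ^+ (j * K)) x = x.
  elim: j => [|j IH]; first by rewrite perm1.
  by rewrite mulSn expgD permM [(rho ^+ K) x]permX /K iter_porbit.
rewrite {1}(divn_eq m K) expgD permM idK /dvdn.
have ltK := ltn_pmod m K_gt0; have := uniq_traject_porbit rho x.
rewrite -/K => /uniqP - /(_ x) inj.
apply/eqP/eqP => [fx | -> ]; last by rewrite perm1.
apply: inj; rewrite ?inE ?size_traject //.
by rewrite !nth_traject //= -permX.
Qed.

Lemma expgV_id x m : ((rho^-1 ^+ m) x == x) = ((rho ^+ m) x == x).
Proof. by rewrite expgVn; apply/eqP/eqP => e; rewrite -{1}e ?permKV ?permK. Qed.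

(** Makes the map from rho^i x to rho^-i y well defined: on both cycles exponents count modulo the
    same length. *)
Lemma expgV_eq x y i j : #|porbit rho x| = #|porbit rho y| ->
  (rho ^+ i) x = (rho ^+ j) x -> (rho^-1 ^+ i) y = (rho^-1 ^+ j) y.
Proof.
move=> exy; wlog le_ij : i j / i <= j => [H | ].
  by case/orP: (leq_total i j) => /H // {}H /esym /H.
rewrite -(subnK le_ij) !expgD !permM => e.
have /eqP : (rho ^+ (j - i)) x = x.
  exact: (@perm_inj _ (rho ^+ i) _ _ (esym e)).
by rewrite porbit_expg_id exy -porbit_expg_id -expgV_id => /eqP ->.
Qed.

(** * Reflections built from two cycles of equal length *)

Definition porbit_index x z := index z (traject rho x #|porbit rho x|).

Lemma porbit_indexP x z : z \in porbit rho x -> (rho ^+ porbit_index x z) x = z.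
Proof.
rewrite porbit_traject => xz; rewrite permX.
have lt_i : porbit_index x z < #|porbit rho x|.
  by rewrite -(size_traject rho x #|_|) index_mem.
by rewrite -(nth_traject rho lt_i) nth_index.
Qed.

(* The involution exchanging [rho^i x] and [rho^-i y]; when [x] and [y] lie on
   the same cycle it is a reflection of that cycle. *)
Definition reflect_fun x y z :=
  if z \in porbit rho x then (rho^-1 ^+ porbit_index x z) y
  else if z \in porbit rho y then (rho^-1 ^+ porbit_index y z) x else z.

Section Reflection.
Variables (x y : T).
Hypothesis exy : #|porbit rho x| = #|porbit rho y|.

Lemma reflect_funl i : reflect_fun x y ((rho ^+ i) x) = (rho^-1 ^+ i) y.
Proof.
by rewrite /reflect_fun mem_porbit; apply/expgV_eq/porbit_indexP/mem_porbit.
Qed.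

Lemma reflect_funr i : reflect_fun x y ((rho ^+ i) y) = (rho^-1 ^+ i) x.
Proof.
rewrite /reflect_fun; case: ifP => [xz | _]; last first.
  rewrite mem_porbit; apply: (@expgV_eq y) => //; exact/porbit_indexP/mem_porbit.
(* Here both points share a cycle and the first branch applies: with y = rho^j x, the point
   rho^(j+i) x goes to rho^-(j+i) y = rho^-i x. *)
have /porbitP[j yE] : y \in porbit rho x.
  by rewrite -(eq_porbit_mem) -(porbit_perm rho i) eq_porbit_mem.
have -> : (rho^-1 ^+ porbit_index x ((rho ^+ i) y)) y = (rho^-1 ^+ (j + i)) y.
  by apply: expgV_eq exy _; rewrite porbit_indexP // expgD permM -yE.
by rewrite expgD permM {1}yE [rho^-1 ^+ j]expgVn permK.
Qed.

Lemma reflect_fun_out z :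
  z \notin porbit rho x :|: porbit rho y -> reflect_fun x y z = z.
Proof. by rewrite inE /reflect_fun => /norP[/negPf-> /negPf->]. Qed.

Lemma porbitU_ind (Q : T -> Prop) :
    (forall i, Q ((rho ^+ i) x)) -> (forall i, Q ((rho ^+ i) y)) ->
  {in porbit rho x :|: porbit rho y, forall z, Q z}.
Proof. by move=> Qx Qy z /setUP[] /porbitP[i ->]. Qed.

Lemma porbit_expgV z i : exists j, (rho^-1 ^+ i) z = (rho ^+ j) z.
Proof.
by apply/porbitP; rewrite -porbitV mem_porbit.
Qed.

(** A negative power rho^-i x is some rho^j x with i + j a multiple of the common length, whence
    rho^-j y = rho^i y. *)
Lemma reflect_funlV i : reflect_fun x y ((rho^-1 ^+ i) x) = (rho ^+ i) y.
Proof.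
have [j e] := porbit_expgV x i; rewrite e reflect_funl.
have /eqP : (rho ^+ (i + j)) x = x.
  by rewrite addnC expgD permM -e expgVn permKV.
rewrite porbit_expg_id exy -porbit_expg_id -expgV_id addnC expgD permM => /eqP.
by move=> {2}<-; rewrite [rho^-1 ^+ i]expgVn permKV.
Qed.

End Reflection.

(** Lets [reflect_funlV], which concerns inverse powers at [x], serve at [y] too. *)
Lemma reflect_funC x y : #|porbit rho x| = #|porbit rho y| ->
  reflect_fun x y =1 reflect_fun y x.
Proof.
move=> exy z; case: (boolP (z \in porbit rho x :|: porbit rho y)) => [|zE].
  by move: z; apply: porbitU_ind => i; rewrite reflect_funl // reflect_funr.
by rewrite reflect_fun_out // reflect_fun_out // setUC.
Qed.

Lemma reflect_funK x y : #|porbit rho x| = #|porbit rho y| ->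
  involutive (reflect_fun x y).
Proof.
move=> exy z; case: (boolP (z \in porbit rho x :|: porbit rho y)) => [|zE].
  move: z; apply: porbitU_ind => i; last by rewrite reflect_funr // reflect_funlV.
  by rewrite reflect_funl // reflect_funC // reflect_funlV.
by rewrite !reflect_fun_out.
Qed.

(** * Involutions inverting [rho] on a subset *)

Definition inverters D : {set {perm T}} :=
  [set s | [&& perm_on D s, s ^+ 2 == 1
             & [forall z in D, s (rho z) == rho^-1 (s z)]]].

Lemma invertersP D s :
  reflect [/\ perm_on D s, s ^+ 2 = 1
            & {in D, forall z, s (rho z) = rho^-1 (s z)}]
          (s \in inverters D).
Proof.
rewrite inE; apply: (iffP and3P) => [[? /eqP ? /forall_inP sV] | [? -> sV]].
  by split=> // z /sV /eqP.
by split=> //; apply/forall_inP => z /sV ->.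
Qed.

Lemma perm_sqr1 s z : s ^+ 2 = 1 -> s (s z) = z.
Proof. by move=> s2; rewrite -permM -[s * s]/(s ^+ 2) s2 perm1. Qed.

Lemma mem_porbit_perm x z : (rho z \in porbit rho x) = (z \in porbit rho x).
Proof. by rewrite -!eq_porbit_mem -(porbit_perm rho 1 z) expg1. Qed.

Section Stable.
Variable D : {set T}.
Hypothesis stD : forall z, (rho z \in D) = (z \in D).

Lemma stable_expg i z : ((rho ^+ i) z \in D) = (z \in D).
Proof. by elim: i => [|i IH]; rewrite ?perm1 // expgSr permM stD. Qed.

Lemma stable_porbit x : x \in D -> porbit rho x \subset D.
Proof. by move=> xD; apply/subsetP => _ /porbitP[i ->]; rewrite stable_expg. Qed.

Lemma inverters_expg s i z : s \in inverters D -> z \in D ->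
  s ((rho ^+ i) z) = (rho^-1 ^+ i) (s z).
Proof.
move=> /invertersP[_ _ sV] zD; elim: i => [|i IH]; first by rewrite !perm1.
by rewrite !expgSr !permM sV ?stable_expg // IH.
Qed.

(** Since [s] carries rho^m to rho^-m, both cycle lengths have the same multiples. *)
Lemma card_porbit_inverters s x : s \in inverters D -> x \in D ->
  #|porbit rho (s x)| = #|porbit rho x|.
Proof.
move=> sD xD.
have same m : (#|porbit rho (s x)| %| m) = (#|porbit rho x| %| m).
  rewrite -!porbit_expg_id -[LHS]expgV_id -(inverters_expg m sD xD).
  exact: (inj_eq perm_inj).
by apply/eqP; rewrite eqn_dvd same dvdnn -same dvdnn.
Qed.

(** The condition s x = y forces [s] to be the reflection [r] on [E]; multiplying by [r] on the left
    matches these [s] with the inverters supported off [E]. *)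
Lemma card_inverters_fibre x y : x \in D -> y \in D ->
    #|porbit rho x| = #|porbit rho y| ->
  #|[set s in inverters D | s x == y]| =
  #|inverters (D :\: (porbit rho x :|: porbit rho y))|.
Proof.
move=> xD yD exy; set E := _ :|: _.
pose r := perm (inv_inj (reflect_funK exy)).
have rE z : r z = reflect_fun x y z by rewrite permE.
have rx : r x = y by rewrite rE -{2}[x]perm1 (reflect_funl exy 0) perm1.
have r2 : r ^+ 2 = 1.
  by apply/permP => z; rewrite permM !rE (reflect_funK exy) perm1.
have stE z : (rho z \in E) = (z \in E) by rewrite !inE !mem_porbit_perm.
have sED : E \subset D by rewrite subUset !stable_porbit.
have yE : y \in E by rewrite inE porbit_id orbT.
have r_out z : z \notin E -> r z = z by rewrite rE; apply: reflect_fun_out.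
have r_on : perm_on E r.
  by apply/subsetP => z; apply: contraR => /r_out /eqP.
have r_in z : (r z \in E) = (z \in E) by apply: perm_closed.
have rx_i i : r ((rho ^+ i) x) = (rho^-1 ^+ i) y by rewrite rE reflect_funl.
have ry_i i : r ((rho ^+ i) y) = (rho^-1 ^+ i) x by rewrite rE reflect_funr.
have rV : {in E, forall z, r (rho z) = rho^-1 (r z)}.
  apply: porbitU_ind => i; rewrite -[rho _]permM -expgSr ?rx_i ?ry_i.
    by rewrite expgSr permM.
  by rewrite expgSr permM.
rewrite -[RHS](card_imset _ (mulgI r)); congr #|pred_of_set _|.
apply/setP => s; rewrite inE; apply/andP/imsetP => [[sD /eqP sx] | [t tDE ->]].
  exists (r * s); last by rewrite mulgA -[r * r]/(r ^+ 2) r2 mul1g.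
  have [s_on s2 sV] := invertersP _ _ sD.
  (* On the cycle of [x] inversion determines [s] from s x = y; on the cycle of [y], from s y =
     x. *)
  have sr : {in E, s =1 r}.
    apply: porbitU_ind => i; rewrite (inverters_expg i sD) // ?sx ?rx_i //.
    by rewrite ry_i -sx perm_sqr1.
  have sE z : (s z \in E) = (z \in E).
    apply/idP/idP => zE; last by rewrite sr // r_in.
    by rewrite -(perm_sqr1 z s2) sr // r_in.
  apply/invertersP; split.
  - apply/subsetP => z; apply: contraR; rewrite in_setD negb_and negbK permM.
    case: (boolP (z \in E)) => [zE _ | zE /= zD].
      by rewrite sr ?r_in // perm_sqr1.
    by rewrite r_out // (out_perm s_on).
  - apply/permP => z; rewrite perm1 !permM.
    case: (boolP (z \in E)) => zE.
      by rewrite [s (r z)]sr ?r_in // (perm_sqr1 z r2) sr ?r_in // perm_sqr1.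
    by rewrite (r_out z zE) r_out ?sE // perm_sqr1.
  - move=> z /setDP[zD zE]; rewrite !permM (r_out z) // r_out ?stE //.
    exact: sV.
have [t_on t2 tV] := invertersP _ _ tDE.
have t_out z : z \in E -> t z = z.
  by move=> zE; apply: (out_perm t_on); rewrite inE zE.
split; last by rewrite permM rx t_out.
apply/invertersP; split.
- apply: perm_onM; first exact: subset_trans r_on sED.
  exact: subset_trans t_on (subsetDl _ _).
(* [r] and [t] have disjoint supports, hence commute. *)
- rewrite expgMn ?r2 ?t2 ?mulg1 //; apply: perm_onC r_on t_on _.
  by rewrite disjoint_sym -setI_eq0 setIDAC setD_eq0 subsetIr.
- move=> z zD; rewrite !permM; case: (boolP (z \in E)) => zE.
    by rewrite t_out ?r_in ?stE // rV // t_out // r_in.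
  by rewrite (r_out z) // r_out ?stE // tV // inE zE.
Qed.

End Stable.

(** * Counting inverters on a union of cycles *)

Lemma trivIset_porbits : trivIset (porbits rho).
Proof.
apply/trivIsetP => _ _ /imsetP[x _ ->] /imsetP[y _ ->]; apply: contraR.
case/pred0Pn => z /= /andP[]; rewrite -!eq_porbit_mem => /eqP xz /eqP yz.
by rewrite -xz -yz.
Qed.

Lemma cover_porbits : cover (porbits rho) = setT.
Proof.
apply/setP => x; rewrite inE; apply/bigcupP.
by exists (porbit rho x); [exact: imset_f | exact: porbit_id].
Qed.

Lemma stable_cover P z : P \subset porbits rho ->
  (rho z \in cover P) = (z \in cover P).
Proof.
move=> sP; apply/bigcupP/bigcupP => -[B PB zB]; exists B => //;
  have /imsetP[x _ eB] := subsetP sP B PB; move: zB;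
  by rewrite eB mem_porbit_perm.
Qed.

Definition porbit_count P i := #|[set B in P | #|B| == i]|.

Lemma porbit_countD1 P B i : B \in P ->
  porbit_count P i = (#|B| == i) + porbit_count (P :\ B) i.
Proof.
move=> PB; rewrite /porbit_count (cardsD1 B) inE PB; congr (_ + _).
by apply: eq_card => A; rewrite !inE andbA.
Qed.

Lemma inverters0 : inverters set0 = [set 1].
Proof.
apply/setP => s; rewrite in_set1; apply/invertersP/eqP => [[s_on _ _] | ->].
  by apply: perm_on_id s_on _; rewrite cards0.
by split; [exact: perm_on1 | rewrite expg1n | move=> z; rewrite inE].
Qed.

(** Classify [s] by y = s x, grouping the [y] by their cycle [B]: it must have the length of the
    cycle of [x], and then each of its points has a fibre of the same size. *)
Lemma card_inverters_cover_rec P x : P \subset porbits rho ->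
    porbit rho x \in P ->
  #|inverters (cover P)| =
  \sum_(B in P | #|B| == #|porbit rho x|)
    #|porbit rho x| * #|inverters (cover (P :\ porbit rho x :\ B))|.
Proof.
move=> sP PC; set C := porbit rho x in PC *; set D := cover P.
have tiP := trivIsetS sP trivIset_porbits.
have stD z : (rho z \in D) = (z \in D) by apply: stable_cover.
have xD : x \in D by apply/bigcupP; exists C; rewrite ?porbit_id.
rewrite -sum1_card (partition_big (fun s : {perm T} => s x) [in D]); last first.
  by move=> s /invertersP[s_on _ _]; rewrite perm_closed.
rewrite big_trivIset // [RHS]big_mkcondr; apply: eq_bigr => B PB.
have /imsetP[y0 _ eB] := subsetP sP B PB.
have BE y : y \in B -> B = porbit rho y.
  by rewrite eB => yB; apply/esym/eqP; rewrite eq_porbit_mem.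
have BD y : y \in B -> y \in D by move=> yB; apply/bigcupP; exists B.
case: eqP => [eBC | neBC]; last first.
  apply: big1 => y yB; apply: big1 => s /andP[sD /eqP sx]; case: neBC.
  by rewrite (BE y yB) -sx (card_porbit_inverters stD sD xD).
rewrite -eBC -sum_nat_const; apply: eq_bigr => y yB.
have eyB := BE y yB.
have -> : cover (P :\ C :\ B) = D :\: (C :|: B).
  (* For B = C the second removal is void. *)
  have [-> | neBC] := eqVneq B C.
    by rewrite setDDl !setUid coverD1.
  by rewrite coverD1 ?coverD1 ?setDDl // ?inE ?neBC // trivIsetD.
rewrite eyB -(card_inverters_fibre stD xD (BD y yB)) -?eyB //.
by rewrite -sum1_card; apply: eq_bigl => s; rewrite !inE.
Qed.

Local Close Scope group_scope.

Lemma card_inverters_cover P : P \subset porbits rho ->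
  #|inverters (cover P)| =
  \prod_(1 <= i < #|T|.+1) Rnat (porbit_count P i) i.
Proof.
have [p] := ubnP #|P|; elim: p => // p IH in P *; rewrite ltnS => leP sP.
have [P0 | [C PC]] := set_0Vmem P.
  rewrite P0 /cover big_set0 inverters0 cards1 big1 // => i _.
  rewrite /porbit_count (_ : [set B in _ | _] = set0) ?cards0 ?Rnat0 //.
  by apply/setP => B; rewrite !inE.
have /imsetP[x _ eC] := subsetP sP C PC; set k := #|C|.
have k_in : k \in index_iota 1 #|T|.+1.
  by rewrite mem_index_iota ltnS max_card andbT lt0n /k eC card_porbit_neq0.
(* The contribution of the other lengths, unchanged when cycles of length [k] are removed. *)
pose W := \prod_(1 <= i < #|T|.+1 | i != k) Rnat (porbit_count P i) i.
have prodE Q : (forall i : nat, i != k -> porbit_count Q i = porbit_count P i) ->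
    \prod_(1 <= i < #|T|.+1) Rnat (porbit_count Q i) i
    = Rnat (porbit_count Q k) k * W.
  move=> eQ; rewrite (bigD1_seq k) ?iota_uniq //; congr (_ * _).
  by apply: eq_bigr => i /eQ ->.
have IHs (Q : {set {set T}}) : Q \subset P :\ C -> #|inverters (cover Q)| =
    \prod_(1 <= i < #|T|.+1) Rnat (porbit_count Q i) i.
  move=> sQ; apply: IH.
    apply: leq_trans leP; rewrite [#|P|](cardsD1 C) PC ltnS.
    exact: subset_leq_card.
  exact: subset_trans sQ (subset_trans (subD1set _ _) sP).
pose m := porbit_count (P :\ C) k.
have ePk : porbit_count P k = m.+1 by rewrite (porbit_countD1 _ PC) eqxx.
have ePC (i : nat) : i != k -> porbit_count (P :\ C) i = porbit_count P i.
  by move=> nik; rewrite (porbit_countD1 _ PC) eq_sym (negPf nik).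
rewrite (card_inverters_cover_rec (x := x)) -?eC // -/k.
(* The term B = C gives k R_m(k) W; each of the [m] other cycles of length [k] gives k R_(m-1)(k)
   W. *)
rewrite (bigD1 C) ?PC ?eqxx //= setDDl setUid IHs // prodE // -/m prodE // ePk.
rewrite (eq_bigr (fun=> k * (Rnat m.-1 k * W))); last first.
  move=> B /andP[/andP[PB /eqP kB] neBC].
  have PCB : B \in P :\ C by rewrite !inE neBC.
  rewrite IHs ?subD1set // prodE; last first.
    move=> i nik; rewrite -ePC // [in RHS](porbit_countD1 _ PCB) kB eq_sym.
    by rewrite (negPf nik).
  by rewrite /m (porbit_countD1 _ PCB) kB eqxx.
rewrite sum_nat_const (_ : #|_| = m); last first.
  by apply: eq_card => B; rewrite !inE /= -topredE /= andbC andbA.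
(* For m = 0 the truncated [m.-1] is harmless, its sum being empty; otherwise [RnatS] applies. *)
case: (m) => [|m']; first by rewrite Rnat0 Rnat1 mul0n addn0 mul1n.
by rewrite RnatS mulnDl -!mulnA [m'.+1 * _]mulnCA.
Qed.

Lemma card_inverters :
  #|inverters setT| =
  \prod_(1 <= i < #|T|.+1) Rnat (count_mem i (cycle_type rho)) i.
Proof.
rewrite -cover_porbits card_inverters_cover //.
apply: eq_bigr => i _; congr Rnat; rewrite /cycle_type.
rewrite (seq.permP (permEl (perm_sort _ _))) count_map -sum1_count big_enum_cond.
by rewrite /porbit_count -sum1_card; apply: eq_bigl => B; rewrite inE.
Qed.

End Inverters.

(** * From factorizations to inverters, and the product formula *)

Lemma card_involution_factorizations n (rho : 'S_n) :
  #|involution_factorizations rho| = #|inverters rho setT|.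
Proof.
(* sigma determines tau = sigma rho, whose square is trivial exactly when sigma rho sigma =
   rho^-1. *)
have f_inj : injective (fun s => (s, s * rho)%g) by move=> s t [].
rewrite -[RHS](card_imset _ f_inj).
apply: eq_card => -[s t]; apply/idP/imsetP => [|[u + [-> ->]]].
  rewrite inE /= => /and3P[/eqP s2 /eqP t2 /eqP st].
  have sK u : (s * (s * u) = u)%g.
    by rewrite mulgA -[(s * s)%g]/(s ^+ 2)%g s2 mul1g.
  have tE : t = (s * rho)%g by rewrite -st sK.
  exists s; last by rewrite tE.
  apply/invertersP; split=> //; first exact/subsetP.
  move=> z _; apply: (@perm_inj _ rho); rewrite permKV -!permM.
  suff -> : (rho * (s * rho) = s)%g by [].
  by rewrite -[LHS]sK [(s * (rho * _))%g]mulgA -tE -[(t * t)%g]/(t ^+ 2)%g t2 mulg1.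
case/invertersP=> _ u2 uV; rewrite inE; apply/and3P; split; apply/eqP => //=.
  by apply/permP => z; rewrite perm1 !permM uV ?inE // permKV perm_sqr1.
by rewrite mulgA -[(u * u)%g]/(u ^+ 2)%g u2 mul1g.
Qed.

Theorem theorem2p1 (n : nat) (n_ge1 : (1 <= n)%N)
    (lam : seq nat) (lam_part : is_partition_of n lam)
    (rho : 'S_n) (rho_type : cycle_type rho = lam) :
  (#|involution_factorizations rho|%:R =
     \prod_(1 <= i < n.+1) Rsum (count_mem i lam) i)%R.
Proof.
rewrite card_involution_factorizations card_inverters card_ord rho_type.
rewrite natr_prod.
by apply: eq_bigr => i _; rewrite Rsum_Rnat.
Qed.
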